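(* If a finite presentation $P$ satisfies condition $\tau'_{<}$, then there is a constant $N<0$ such that $\kappa(v)\le N$ for every reduced diagram $\Delta$ over $P$ (with no interior vertices of degree $2$) and every interior vertex $v\in\Delta$.
   Context: **Presentations and diagrams.** For a presentation $P=\langle X\mid R\rangle$ the relators are assumed cyclically reduced, and no relator is a cyclic permutation of another relator or of the inverse of another relator. $R^*$ is the set of all cyclic permutations of elements of $R$ and of their inverses. A piece is a word which is a common prefix of two different elements of $R^*$. $K_P$ is the standard $2$-complex of $P$. A diagram over $P$ is a combinatorial map $\varphi\colon M\to K_P$ (open cells map homeomorphically onto open cells), where $M$ is obtained from a combinatorial cell structure on the $2$-sphere by removing some (possibly none) open $2$-cells; it is a spherical, disk or annular diagram if respectively $0$, $1$, $2$ open $2$-cells are removed. $\partial M$ is the boundary of $M$ in the sphere. Cells of dimension $0,1,2$ are called vertices, edges, faces. Via $\varphi$, edges of $M$ are labeled by elements of $X$ and their inverses, and the boundary label of an oriented face, read from any vertex, is an element of $R^*$. A diagram is reducible if it contains two faces $f,f'$ such that $\partial f\cap\partial f'$ contains an edge $e$ for which the boundary labels of $f$ and $f'$, read with opposite orientations and starting at an endpoint of $e$ (traversing $e$ first), coincide; otherwise it is reduced. The degree $d(v)$ of a vertex $v$ is the number of edges incident to $v$ (loops counted twice). A vertex is interior if it is not in $\partial M$. **Convention.** In a reduced diagram, interior vertices of degree $2$ are removed (merging the two incident edges), so that interior edges are labeled by pieces; the length $\ell(e)$ of such an edge is the length of its label, i.e. the number of original edges glued to form it. **Condition $\tau'_{<}$.**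 A corner $c$ of a face $f$ at an interior vertex $v$ lies between two consecutive edges at $v$, of lengths $\ell_1(c),\ell_2(c)$; $\ell_r(c)$ is the length of the relator corresponding to $f$. Put $d'_F(v)=\sum_{c\ni v}\frac{\ell_1(c)+\ell_2(c)}{\ell_r(c)}$, the sum over all corners at $v$. $P$ satisfies $\tau'_{<}$ if $d'_F(v)<d(v)-2$ for every interior vertex $v$ of every reduced diagram over $P$ (with no interior vertices of degree $2$). **Curvature.** A corner $c$ at an interior vertex is assigned the weight (angle) $w(c)=\pi-\frac{\ell_1(c)+\ell_2(c)}{\ell_r(c)}\pi$. The curvature of a vertex $v$ is $\kappa(v)=2\pi-\pi\chi(\mathrm{lk}_v)-\sum_{c\ni v}w(c)$, where $\chi(\mathrm{lk}_v)$ is the Euler characteristic of the link of $v$ (for an interior vertex the link is a circle, so $\chi(\mathrm{lk}_v)=0$). *)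

(* Defs.v *)
From HB Require Import structures.
From mathcomp Require Import all_boot all_order all_algebra fingroup perm.
From mathcomp Require Import all_classical all_reals all_analysis.

Set Implicit Arguments.
Unset Strict Implicit.
Unset Printing Implicit Defensive.

Import Order.TTheory GRing.Theory Num.Theory.
Local Open Scope ring_scope.

(* The letter (x, true) is the generator x, and (x, false) is its inverse. *)
Definition word (X : Type) : Type := seq (X * bool).
Definition inv_letter (X : Type) (a : X * bool) : X * bool := (a.1, ~~ a.2).
Definition inv_word (X : Type) (w : word X) : word X :=
  rev (map (@inv_letter X) w).

(* [path.cycle] also compares the last letter with the first one. *)
Definition cyclically_reduced (X : choiceType) (w : word X) : bool :=
  path.cycle (fun a b : X * bool => b != inv_letter a) w.

Definition cyclic_perm (X : Type) (w w' : word X) : Prop :=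
  exists k : nat, w = rot k w'.

Record presentation := Presentation {
  generator : choiceType;
  relator : set (word generator);
  relator_cyclically_reduced :
    forall r, relator r -> cyclically_reduced r;
  relator_irredundant :
    forall r s, relator r -> relator s -> r <> s ->
      ~ cyclic_perm r s /\ ~ cyclic_perm r (inv_word s)
}.

Definition finite_presentation (P : presentation) : Prop :=
  finite_set [set: generator P]%classic /\ finite_set (@relator P).

(* The set R^* *)
Definition relator_star (P : presentation) (w : word (generator P)) : Prop :=
  exists2 r, relator r & cyclic_perm w r \/ cyclic_perm w (inv_word r).

(* A cell structure on the 2-sphere, encoded by its darts (oriented edges):
   [edge_perm] reverses a dart and [node_perm] rotates a dart counterclockwise
   around its origin.  A vertex is an orbit of [node_perm] (the darts issuing
   from it), and a 2-cell is an orbit of [face_perm] (the darts having the cell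
   on their left); the surface is a sphere by connectedness and V - E + F = 2. *)
Record sphere_map := SphereMap {
  dart :> finType;
  edge_perm : {perm dart};
  node_perm : {perm dart};
  edge_permK : involutive edge_perm;
  edge_perm_neq : forall d, edge_perm d != d;
  sphere_connected : forall d d' : dart,
    connect (fun x y => (y == edge_perm x) || (y == node_perm x)) d d';
  sphere_euler :
    (#|porbits node_perm| + #|porbits (edge_perm * node_perm^-1)%g|
     = #|porbits edge_perm| + 2)%N
}.

Section SphereMap.
Variable S : sphere_map.

(* From the head of d, the boundary walk of the cell on the left (resp. on the
   right) of d continues with the dart that comes just before (resp. after) the
   reverse of d in the counterclockwise order.  (In {perm _}, (s * t) x is
   t (s x).) *)
Definition face_perm : {perm S} := (edge_perm S * (node_perm S)^-1)%g.
Definition right_face_perm : {perm S} := (edge_perm S * node_perm S)%g.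

Definition vertex_of (d : S) : {set S} := porbit (node_perm S) d.
Definition face_of (d : S) : {set S} := porbit face_perm d.

End SphereMap.

(* A diagram is a sphere map with some 2-cells removed.  The combinatorial map
   to K_P is recorded by the labels that it induces on the darts. *)
Record diagram (P : presentation) := Diagram {
  carrier :> sphere_map;
  removed : {set {set carrier}};
  removed_faces : removed \subset porbits (face_perm carrier);
  label : carrier -> generator P * bool;
  label_edge : forall d, label (edge_perm carrier d) = inv_letter (label d);
  label_face : forall d, face_of d \notin removed ->
    relator_star (map label (orbit (face_perm carrier) d))
}.

Section Diagram.
Variables (P : presentation) (M : diagram P).

(* The label of the boundary of the cell on the left (resp. right) of d, read
   along d and starting at the origin of d. *)
Definition left_label (d : M) : word (generator P) :=
  map (@label P M) (orbit (face_perm M) d).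
Definition right_label (d : M) : word (generator P) :=
  map (@label P M) (orbit (right_face_perm M) d).

Definition reducible : Prop :=
  exists d : M,
    [/\ face_of d \notin removed M,
        face_of (edge_perm M d) \notin removed M,
        face_of d <> face_of (edge_perm M d)
      & left_label d = right_label d].

Definition reduced : Prop := ~ reducible.

Definition vertices : {set {set M}} := porbits (node_perm M).

(* The boundary of M in the sphere is the union of the boundaries of the
   removed cells. *)
Definition interior_vertex (v : {set M}) : bool :=
  (v \in vertices) && [forall d in v, face_of d \notin removed M].

(* A loop contributes two darts. *)
Definition degree (v : {set M}) : nat := #|v|.

(* The vertices removed when the two incident edges are merged. *)
Definition merged_vertex (v : {set M}) : bool :=
  interior_vertex v && (degree v == 2).

(* The length of the edge starting with the dart d after merging: follow d,
   going straight on (by [right_face_perm]) as long as the head of the current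
   dart is a merged vertex, and count the darts.  If d issues from a vertex that
   is not merged, this stops after at most #|M| darts. *)
Definition edge_length (d : M) : nat :=
  (find (fun x => ~~ merged_vertex (vertex_of (edge_perm M x)))
        (traject (right_face_perm M) d #|M|)).+1.

(* The corner between the consecutive darts c and [node_perm M c] is encoded by
   c; it belongs to the 2-cell on the left of c. *)
Definition corners (v : {set M}) : {set M} :=
  finset (fun c : M => (c \in v) && (face_of c \notin removed M)).

Definition corner_length1 (c : M) : nat := edge_length c.
Definition corner_length2 (c : M) : nat := edge_length (node_perm M c).
(* A boundary label is a cyclic permutation of the relator or of its inverse. *)
Definition corner_relator_length (c : M) : nat := size (left_label c).

(* The vertices of the link are the darts at v, its edges are the corners. *)
Definition link_euler (v : {set M}) : int := #|v|%:Z - #|corners v|%:Z.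

Variable R : realType.

Definition corner_ratio (c : M) : R :=
  ((corner_length1 c)%:R + (corner_length2 c)%:R) / (corner_relator_length c)%:R.

Definition dF' (v : {set M}) : R := \sum_(c in corners v) corner_ratio c.

Definition corner_weight (c : M) : R := pi - corner_ratio c * pi.

Definition curvature (v : {set M}) : R :=
  2 * pi - pi * (link_euler v)%:~R - \sum_(c in corners v) corner_weight c.

End Diagram.

(* The vertices left after the interior vertices of degree 2 have been merged
   are those with [~~ merged_vertex v]; their degrees and corners do not change. *)
Definition tau'_lt (R : realType) (P : presentation) : Prop :=
  forall (M : diagram P) (v : {set M}),
    reduced M -> interior_vertex v -> ~~ merged_vertex v ->
    dF' R v < (degree v)%:R - 2.

(* Main.v *)
Require Import Defs.
From HB Require Import structures.
From mathcomp Require Import all_boot all_order all_algebra fingroup perm.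
From mathcomp Require Import all_classical all_reals all_analysis.
From mathcomp Require Import ring lra.

(** At an interior vertex the curvature is [pi * (dF' v - (d(v) - 2))], so the
    hypothesis says that it is negative; the issue is a bound uniform in [v],
    although degrees are unbounded.  This is an integrality argument: there are
    finitely many relators, hence an integer [D > 0] divisible by all their
    nonzero lengths, and then [D * dF' v] is an integer, since [dF' v] is a sum
    of integers divided by relator lengths.  The strict inequality [D * dF' v < D * (d(v) - 2)] between
    integers has a gap of at least [1], so the curvature is at most [- pi / D]. *)

Set Implicit Arguments.
Unset Strict Implicit.
Unset Printing Implicit Defensive.

Import Order.TTheory GRing.Theory Num.Theory.
Local Open Scope ring_scope.

Lemma size_relator_star (P : presentation) (w : word (generator P)) :
  relator_star w -> exists2 r, @relator P r & size w = size r.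
Proof.
case=> r Rr [] [k ->]; exists r => //; rewrite size_rot //.
by rewrite /inv_word size_rev size_map.
Qed.

Lemma size_relator_bounded (P : presentation) :
  finite_set (@relator P) ->
  exists B : nat, forall r, @relator P r -> (size r <= B)%N.
Proof.
case/finite_fsetP=> A RA; exists (\max_(r <- finmap.enum_fset A) size r)%N.
by move=> r; rewrite RA => Ar; exact: leq_bigmax_seq.
Qed.

(** The presentation may contain the empty relator, hence the restriction to
    nonempty words; the boundary label of a face is one of these. *)
Lemma common_relator_multiple (P : presentation) :
  finite_set (@relator P) ->
  exists2 D : nat, (0 < D)%N &
    forall w : word (generator P),
      relator_star w -> (0 < size w)%N -> (size w %| D)%N.
Proof.
case/size_relator_bounded=> B leB; exists B`!%N; first exact: fact_gt0.
move=> w /size_relator_star[r /leB le_rB ->] r_gt0.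
by apply: dvdn_fact; rewrite r_gt0.
Qed.

Section InteriorVertex.
Variables (P : presentation) (M : diagram P) (R : realType).

Lemma corner_relator_length_gt0 (c : M) : (0 < corner_relator_length c)%N.
Proof.
by rewrite /corner_relator_length size_map size_orbit fingraph.order_gt0.
Qed.

Lemma corners_interior (v : {set M}) : interior_vertex v -> corners v = v.
Proof.
case/andP=> _ /forallP kept; apply/setP=> c; rewrite inE.
by case: (boolP (c \in v)) => //= cv; have := kept c; rewrite cv.
Qed.

(** The link of an interior vertex is a circle, so the curvature is [2 * pi]
    minus the sum of the [degree v] angles [pi - ratio * pi]. *)
Lemma curvature_interior (v : {set M}) :
  interior_vertex v -> curvature R v = pi * (dF' R v - ((degree v)%:R - 2)).
Proof.
move=> iv; rewrite /curvature /link_euler /dF' /corner_weight /degree.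
rewrite corners_interior // subrr mulr0 subr0.
by rewrite sumrB sumr_const -mulr_suml -mulr_natr; ring.
Qed.

Lemma dF'_clear_denominators (D : nat) (v : {set M}) :
  (forall c, c \in corners v -> (corner_relator_length c %| D)%N) ->
  exists k : nat, dF' R v * D%:R = k%:R.
Proof.
move=> dvD.
exists (\sum_(c in corners v) (corner_length1 c + corner_length2 c) *
          (D %/ corner_relator_length c))%N.
rewrite /dF' mulr_suml natr_sum; apply: eq_bigr => c /dvD dv.
rewrite /corner_ratio natrM natrD -mulrA; congr (_ * _).
rewrite -{1}(divnK dv) natrM mulrCA mulVf ?mulr1 //.
by rewrite pnatr_eq0 -lt0n corner_relator_length_gt0.
Qed.

End InteriorVertex.

(** This is where uniformity comes from: multiplied by [D], both sides become
    integers, so strictness costs a whole unit, whatever the degree [d] is. *)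
Lemma gap_of_common_denominator (R : realType) (x : R) (D k d : nat) :
  (0 < D)%N -> x * D%:R = k%:R -> x < d%:R - 2 ->
  x - (d%:R - 2) <= - D%:R^-1.
Proof.
move=> D_gt0 xD x_lt; have D_gt0R : 0 < D%:R :> R by rewrite ltr0n.
(* [2] is moved to the left, where natural numbers need no subtraction. *)
have : (k + 2 * D < d * D)%N.
  rewrite -(ltr_nat R) natrD !natrM -xD -mulrDl ltr_pM2r //.
  by rewrite -ltrBrDr.
rewrite -(ler_nat R) -addn1 !natrD !natrM -xD => gap.
rewrite -(ler_pM2r D_gt0R) mulNr mulVf ?gt_eqF //.
lra.
Qed.

Theorem corollary5p3 (R : realType) (P : presentation)
    (finP : finite_presentation P) (tauP : tau'_lt R P) :
  exists N : R, N < 0 /\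
    forall (M : diagram P) (v : {set M}),
      reduced M -> interior_vertex v -> ~~ merged_vertex v ->
      curvature R v <= N.
Proof.
have [D D_gt0 dvD] := common_relator_multiple finP.2.
exists (- (pi / D%:R)); split.
  by rewrite oppr_lt0 divr_gt0 ?pi_gt0 ?ltr0n.
move=> M v redM iv nmv; rewrite curvature_interior // -mulrN.
rewrite ler_pM2l ?pi_gt0 //.
have [|k Dk] := @dF'_clear_denominators P M R D v.
  move=> c; rewrite inE => /andP[_ kept].
  by apply: dvD (corner_relator_length_gt0 c); exact: label_face.
exact: gap_of_common_denominator D_gt0 Dk (tauP M v redM iv nmv).
Qed.
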